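(* Let $(u(x,t),\Theta(x,t))$ be a sufficiently smooth solution of the Biot thermoelasticity system $$-\operatorname{div}\sigma^{*}[u,\Theta]=0 \ \text{ in }\Omega\times[0,T],\qquad \chi\,\frac{\partial\Theta}{\partial t}=\kappa_0\Delta\Theta-\Theta_0\beta\,\frac{\partial}{\partial t}(\operatorname{div}u)\ \text{ in }\Omega\times(0,T],$$ with boundary and initial conditions $$u=u_D \text{ on }\Gamma_D^u\times[0,T],\quad \sigma^{*}[u,\Theta]n=0 \text{ on }\Gamma_N^u\times[0,T],\quad \Theta=\Theta_D\text{ on }\Gamma_D^\Theta\times[0,T],\quad \frac{\partial\Theta}{\partial n}=0\text{ on }\Gamma_N^\Theta\times[0,T],\quad \Theta(\cdot,0)=\Theta_*\text{ in }\Omega.$$ Suppose in addition that $u_D$ does not depend on $t$ and that $\Theta_D=\Theta_0$. Then $$\frac{d}{dt}\Big(E_{el}(u(t))+E_{th}(\Theta(t))\Big)=-\frac{\kappa_0}{\Theta_0}\int_\Omega|\nabla\Theta(t)|^2\,dx\le 0 .$$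
   Context: $\Omega\subset\mathbb{R}^d$ ($d=2$ or $3$) is a bounded domain with boundary $\Gamma=\partial\Omega$ and outward unit normal $n$, and $T>0$. The boundary is split as $\Gamma=\Gamma_D^u\cup\Gamma_N^u$ with $\Gamma_D^u\cap\Gamma_N^u=\emptyset$, and also as $\Gamma=\Gamma_D^\Theta\cup\Gamma_N^\Theta$ with $\Gamma_D^\Theta\cap\Gamma_N^\Theta=\emptyset$; the $(d-1)$-dimensional volume of $\Gamma_D^u$ is positive. The unknowns are the displacement $u(x,t)\in\mathbb{R}^d$ and the temperature $\Theta(x,t)\in\mathbb{R}$; write $u(t)=u(\cdot,t)$, $\Theta(t)=\Theta(\cdot,t)$. The data are $u_D$ (boundary displacement), $\Theta_D$ (boundary temperature), $\Theta_*$ (initial temperature). Constants: Lam\'e constants $\mu>0$, $\lambda>-\frac{2\mu}{d}$; coefficient of linear thermal expansion $a_L>0$; $\beta:=a_L(d\lambda+2\mu)$; reference temperature $\Theta_0>0$; volumetric heat capacity $\chi>0$; thermal conductivity $\kappa_0>0$. Strain and stress: $e[u]$ is the symmetric gradient, $e[u]_{ij}=\frac12(\partial_{x_j}u_i+\partial_{x_i}u_j)$; $\sigma[u]:=\lambda(\operatorname{div}u)I+2\mu e[u]$, with $I$ the $d\times d$ identity; $\sigma^*[u,\Theta]:=\sigma[u]-\beta(\Theta-\Theta_0)I$. For matrices, $A:B=\sum_{i,j}A_{ij}B_{ij}$; the divergence of a matrix field is taken row-wise. Energies: $E_{el}(v):=\frac12\int_\Omega\sigma[v]:e[v]\,dx$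 and $E_{th}(\Theta):=\frac{\chi}{2\Theta_0}\int_\Omega|\Theta(x)-\Theta_0|^2\,dx$. ''Sufficiently smooth'' means regular enough (including the boundary of the domain) that all expressions make classical sense, one may differentiate under the integral sign in time, and Green's formula (integration by parts on $\Omega$) is valid. *)

(* Defs.v *)
From HB Require Import structures.
From mathcomp Require Import all_boot all_order all_algebra.
From mathcomp Require Import all_classical all_reals all_analysis.

Set Implicit Arguments.
Unset Strict Implicit.
Unset Printing Implicit Defensive.
Import Order.TTheory GRing.Theory Num.Theory.
Import numFieldNormedType.Exports.

Local Open Scope classical_set_scope.
Local Open Scope ring_scope.

Fact measure_rV_display : measure_display.
Proof. by []. Qed.

Section measurable_rV.
Context {R : realType} (n : nat).

Let coors (i : 'I_n) (v : 'rV[R]_n) : R := v ord0 i.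

Let rV_set0 : g_sigma_preimage coors set0.
Proof. exact: sigma_algebra0. Qed.

Let rV_setC A : g_sigma_preimage coors A -> g_sigma_preimage coors (~` A).
Proof. exact: sigma_algebraC. Qed.

Let rV_bigcup (F : _^nat) : (forall i, g_sigma_preimage coors (F i)) ->
  g_sigma_preimage coors (\bigcup_i (F i)).
Proof. exact: sigma_algebra_bigcup. Qed.

(* The product sigma-algebra on R^n (which is also the Borel sigma-algebra). *)
HB.instance Definition _ := @isMeasurable.Build measure_rV_display
  'rV[R]_n (g_sigma_preimage coors) rV_set0 rV_setC rV_bigcup.

Lemma measurable_coor (i : 'I_n) :
  measurable_fun [set: 'rV[R]_n] (fun v : 'rV[R]_n => v ord0 i).
Proof.
move=> _ Y mY; rewrite setTI; apply: sub_sigma_algebra => /=.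
rewrite -bigcup_seq/=; exists i => /=; first by rewrite mem_index_enum.
by exists Y => //; rewrite setTI.
Qed.

Lemma measurable_fun_rVP d (T : measurableType d) (f : T -> 'rV[R]_n) :
  (forall i, measurable_fun [set: T] (fun x => f x ord0 i)) ->
  measurable_fun [set: T] f.
Proof.
move=> mf.
have H : g_sigma_preimage (fun i => coors i \o f) `<=` measurable.
  apply: smallest_sub; first exact: sigma_algebra_measurable.
  move=> A; rewrite -bigcup_seq/= => -[i _ [B mB <-]].
  exact: mf.
move=> _ A mA; apply: H.
by rewrite g_sigma_preimage_comp; exists A.
Qed.

End measurable_rV.

Section lebesgue_rV.
Context {R : realType}.

Definition rV_cons n (p : R * 'rV[R]_n) : 'rV[R]_n.+1 :=
  \row_i if unlift ord0 i is Some j then p.2 ord0 j else p.1.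

Lemma measurable_rV_cons n : measurable_fun [set: R * 'rV[R]_n] (@rV_cons n).
Proof.
apply: measurable_fun_rVP => i; under eq_fun do rewrite mxE.
case: unliftP => [j _|_]; last exact: measurable_fst.
apply: (measurableT_comp (measurable_coor j)); exact: measurable_snd.
Qed.

Definition rV_uncons n (v : 'rV[R]_n.+1) : R * 'rV[R]_n :=
  (v ord0 ord0, \row_i v ord0 (lift ord0 i)).

Lemma measurable_rV_uncons n :
  measurable_fun [set: 'rV[R]_n.+1] (@rV_uncons n).
Proof.
apply/measurable_fun_pairP; split; first exact: measurable_coor.
apply: measurable_fun_rVP => i /=.
by under eq_fun do rewrite mxE; exact: measurable_coor.
Qed.

Lemma rV_consK n : cancel (@rV_cons n) (@rV_uncons n).
Proof.
move=> [x v]; rewrite /rV_uncons /rV_cons !mxE unlift_none; congr pair.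
by apply/rowP => i; rewrite !mxE liftK.
Qed.

Lemma rV_unconsK n : cancel (@rV_uncons n) (@rV_cons n).
Proof.
move=> v; apply/rowP => i; rewrite !mxE.
by case: unliftP => [j ->|->] /=; rewrite ?mxE.
Qed.

Section step.
Context n (m : {sigma_finite_measure set 'rV[R]_n -> \bar R}).

Definition lebesgue_rV_step : set 'rV[R]_n.+1 -> \bar R :=
  pushforward (lebesgue_measure \x m)%E (@rV_cons n).

Let step0 : lebesgue_rV_step set0 = 0%E.
Proof. by rewrite /lebesgue_rV_step /pushforward preimage_set0 measure0. Qed.

Let mcons A : measurable A -> measurable (@rV_cons n @^-1` A).
Proof.
by move=> mA; rewrite -[X in measurable X]setTI; exact: measurable_rV_cons.
Qed.

Let step_ge0 A : (0 <= lebesgue_rV_step A)%E.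
Proof. exact: (measure_ge0 (lebesgue_measure \x m)%E). Qed.

Let step_sigma_additive : semi_sigma_additive lebesgue_rV_step.
Proof.
move=> F mF tF mUF; rewrite /lebesgue_rV_step /pushforward preimage_bigcup.
apply: measure_semi_sigma_additive.
- by move=> k; exact: mcons.
- apply/trivIsetP => /= i j _ _ ij; rewrite -preimage_setI.
  by move/trivIsetP : tF => /(_ _ _ _ _ ij) ->//; rewrite preimage_set0.
- by rewrite -preimage_bigcup; exact: mcons.
Qed.

HB.instance Definition _ := isMeasure.Build _ _ _
  lebesgue_rV_step step0 step_ge0 step_sigma_additive.

Let step_sigma_finite : sigma_finite [set: 'rV[R]_n.+1] lebesgue_rV_step.
Proof.
have /sigma_finiteP[F [TF ndF Foo]] :=
  sigma_finiteT (lebesgue_measure :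
    {sigma_finite_measure set (measurableTypeR R) -> \bar R}).
have /sigma_finiteP[G [TG ndG Goo]] := sigma_finiteT m.
exists (fun k => @rV_uncons n @^-1` (F k `*` G k)).
  apply/esym; rewrite -subTset => v _.
  have [i _ Fi] : (\bigcup_i F i) (rV_uncons v).1 by rewrite -TF.
  have [j _ Gj] : (\bigcup_i G i) (rV_uncons v).2 by rewrite -TG.
  exists (maxn i j) => //; split.
    by move: Fi; exact/subsetPset/ndF/leq_maxl.
  by move: Gj; exact/subsetPset/ndG/leq_maxr.
move=> k; have [mF Foo_] := Foo k; have [mG Goo_] := Goo k; split.
  rewrite -[X in measurable X]setTI; apply: measurable_rV_uncons => //.
  exact: measurableX.
rewrite /lebesgue_rV_step /pushforward (_ : _ @^-1` _ = F k `*` G k); last first.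
  by apply/seteqP; split => x; rewrite /preimage /mkset rV_consK.
by rewrite product_measure1E// lte_mul_pinfty// ge0_fin_numE.
Qed.

HB.instance Definition _ := Measure_isSigmaFinite.Build _ _ _
  lebesgue_rV_step step_sigma_finite.

End step.

Fixpoint lebesgue_rV n : {sigma_finite_measure set 'rV[R]_n -> \bar R} :=
  if n is n'.+1 then lebesgue_rV_step (lebesgue_rV n') else \d_(0 : 'rV[R]_0).

End lebesgue_rV.

Section calculus.
Context {R : realType}.

(* C^k on an open set U of a finite-dimensional space: all iterated directional
   derivatives of order at most k exist and are continuous on U. *)
Fixpoint Ck_on (V : normedModType R) (k : nat) (U : set V) (f : V -> R) : Prop :=
  (forall x, U x -> {for x, continuous f}) /\
  (if k is k'.+1 then
     forall v, (forall x, U x -> derivable f x v) /\ Ck_on k' U ('D_v f)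
   else True).

(* C^k up to the boundary of a closed set K: f is C^k on an open set
   containing K. *)
Definition Ck_closed (V : normedModType R) (k : nat) (K : set V) (f : V -> R) :=
  exists U : set V, [/\ open U, K `<=` U & Ck_on k U f].

Context {d : nat}.
Implicit Types (x y v w : 'rV[R]_d) (f : 'rV[R]_d -> R)
  (F : 'rV[R]_d -> 'rV[R]_d) (S : 'rV[R]_d -> 'M[R]_d) (A : set 'rV[R]_d).

Definition dot v w : R := \sum_i v ord0 i * w ord0 i.

(* The library norm `|v| on row vectors is the sup norm. *)
Definition enorm v : R := Num.sqrt (dot v v).

Definition frobenius (M N : 'M[R]_d) : R := \sum_i \sum_j M i j * N i j.

Definition partial (i : 'I_d) f x : R := 'D_(delta_mx ord0 i) f x.

Definition gradient f x : 'rV[R]_d := \row_i partial i f x.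

Definition divergence F x : R := \sum_i partial i (fun y => F y ord0 i) x.

Definition mx_divergence S x : 'rV[R]_d :=
  \row_i divergence (fun y => row i (S y)) x.

Definition laplacian f x : R := \sum_i partial i (partial i f) x.

Definition boundary A : set 'rV[R]_d := closure A `\` A°.

Definition ediam A : \bar R :=
  ereal_sup (0%E |` [set (enorm (x - y))%:E | x in A & y in A]).

Definition hausdorff_pre (s : nat) (delta : R) A : \bar R :=
  ereal_inf [set (\sum_(k <oo) ediam (U k) ^+ s)%E | U in
    [set U : (set 'rV[R]_d)^nat |
       A `<=` \bigcup_k U k /\ forall k, (ediam (U k) <= delta%:E)%E]].

(* s-dimensional Hausdorff (outer) measure, normalized by vol(B_s) / 2 ^ s, with
   B_s the Euclidean unit ball of R^s, so that it is the s-dimensional volume. *)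
Definition hausdorff (s : nat) A : \bar R :=
  ((fine (lebesgue_rV s
      [set w : 'rV[R]_s | (\sum_i w ord0 i ^+ 2 <= 1)%R]) / 2 ^+ s)%:E *
   ereal_sup [set hausdorff_pre s delta A | delta in [set delta : R | (0 < delta)%R]])%E.

(* Near x, the set A is the sublevel set {phi < 0} of a C^1 function phi with
   nonzero gradient at x. *)
Definition outward_unit_normal A x v : Prop :=
  exists (phi : 'rV[R]_d -> R) (V : set 'rV[R]_d),
    [/\ open V /\ V x, Ck_on 1 V phi,
        forall y, V y -> (A y <-> phi y < 0),
        phi x = 0 /\ gradient phi x != 0
      & v = (enorm (gradient phi x))^-1 *: gradient phi x].

(* The outward unit normal (unique where it exists), and 0 at the points of the
   boundary where it does not exist. *)
Definition unit_normal A x : 'rV[R]_d := xget 0 [set v | outward_unit_normal A x v].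

Definition green_formula A : Prop :=
  forall F f,
    (forall i, Ck_closed 1 (closure A) (fun x => F x ord0 i)) ->
    Ck_closed 1 (closure A) f ->
    (\int[hausdorff d.-1]_(x in boundary A) (f x * dot (F x) (unit_normal A x))%:E =
     (\int[lebesgue_rV d]_(x in A)
        (divergence F x * f x + dot (F x) (gradient f x)))%:E)%E.

(* Bounded domains whose boundary is regular enough: the normal exists almost
   everywhere on the boundary for the surface measure (so that, e.g., polyhedra
   are allowed) and Green's formula is valid. *)
Record regular_bounded_domain A : Prop := {
  domain_open : open A;
  domain_connected : connected A;
  domain_nonempty : A !=set0;
  domain_bounded : bounded_set A;
  domain_normal : hausdorff d.-1
    [set x | boundary A x /\ ~ exists v, outward_unit_normal A x v] = 0%E;
  domain_green : green_formula A }.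

End calculus.

Section thermoelasticity.
Context {R : realType} {d : nat}.
Implicit Types (u : 'rV[R]_d -> 'rV[R]_d) (Th : 'rV[R]_d -> R)
  (Om : set 'rV[R]_d).

Definition strain u x : 'M[R]_d :=
  \matrix_(i, j) (2^-1 * (partial j (fun y => u y ord0 i) x +
                          partial i (fun y => u y ord0 j) x)).

Definition stress (la mu : R) u x : 'M[R]_d :=
  (la * divergence u x)%:M + (2 * mu) *: strain u x.

Definition thermal_stress (la mu be Th0 : R) u Th x : 'M[R]_d :=
  stress la mu u x - (be * (Th x - Th0))%:M.

Definition elastic_energy Om (la mu : R) u : R :=
  2^-1 * \int[lebesgue_rV d]_(x in Om) frobenius (stress la mu u x) (strain u x).

Definition thermal_energy Om (chi Th0 : R) Th : R :=
  chi / (2 * Th0) * \int[lebesgue_rV d]_(x in Om) `|Th x - Th0| ^+ 2.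

End thermoelasticity.

(* Main.v *)
Require Import Defs.
From mathcomp Require Import all_boot all_order all_algebra.
From mathcomp Require Import all_classical all_reals all_analysis.
From mathcomp Require Import measurable_realfun ring lra.

Set Implicit Arguments.
Unset Strict Implicit.
Unset Printing Implicit Defensive.
Import Order.TTheory GRing.Theory Num.Theory.
Import numFieldNormedType.Exports.

Local Open Scope classical_set_scope.
Local Open Scope ring_scope.

(** Both energies are integrals over Om of polynomials in first derivatives of
    u and in Th, so they may be differentiated in time under the integral sign
    (is_derive_Rintegral). Write w for the velocity du/dt. Mixed derivatives
    commute (derive_swap), so the strain rate is the strain of w, and since
    the bilinear form (e, e') |-> sigma(e) : e' is symmetric, the elastic energy
    changes at the rate int sigma[u] : grad w (elastic_density_rate,
    stress_strain_gradient).

    Green's formula is then used twice. Applied to the rows of the thermal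
    stress and to w, it gives int sigma* : grad w = 0 (power_balance): the
    divergence vanishes by equilibrium, and on the boundary either the traction
    vanishes or u is prescribed independently of time, so that w = 0. Hence
      d/dt E_el = int be (Th - Th0) div w.
    Applied to grad Th and Th - Th0, it gives
      int (lap Th) (Th - Th0) = - int |grad Th|^2   (heat_balance).
    The heat equation turns d/dt E_th = (chi / Th0) int (Th - Th0) dTh/dt into
      - (ka0 / Th0) int |grad Th|^2 - int be (Th - Th0) div w,
    and in the sum the coupling terms cancel (energy_identity).

    The end points of the time interval need care. The data are smooth on an
    open set W containing [0, T] x closure Om, so all time derivatives there are
    two-sided, but the heat equation is assumed only for t > 0, and the boundary
    displacement is constant only inside [0, T]; both identities reach the end
    points by continuity (vanish_on_time_interval).

    All fields are handled as functions on space-time, where smoothness is a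
    property on the fixed open set W, and are sliced at a given time only when
    they are integrated. *)

(** * Lebesgue measure on row vectors *)

Lemma ball_rVP (R : realType) n (q v : 'rV[R]_n) (r : R) :
  0 < r -> ball q r v <-> forall i, `|q ord0 i - v ord0 i| < r.
Proof.
move=> r0; split; first by case=> _ + i; apply.
by move=> h; split=> // i j; rewrite (ord1 i); exact: h.
Qed.

(** The sigma-algebra is generated by the coordinates, so it contains the boxes
    with rational centre and radius 1 / (k + 1); there are countably many of
    these, and every open set is the union of those that it contains. *)
Lemma open_measurable_rV (R : realType) n (A : set 'rV[R]_n) :
  open A -> measurable A.
Proof.
move=> oA.
pose B (p : 'rV[rat]_n * nat) : set 'rV[R]_n :=
  \bigcap_(i in [set: 'I_n])
    [set v : 'rV[R]_n | `|ratr (p.1 ord0 i) - v ord0 i| < p.2.+1%:R^-1].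
have mB p : measurable (B p).
  apply: fin_bigcap_measurable; first exact: finite_finset.
  move=> i _.
  have := @measurable_coor R n i measurableT
    (ball (ratr (p.1 ord0 i) : R) p.2.+1%:R^-1)
    (open_measurable (ball_open _ _)).
  by rewrite setTI.
pose D := [set p | B p `<=` A].
have -> : A = \bigcup_(p in D) B p.
  apply/seteqP; split; last by move=> v [p /= Dp] /Dp.
  move=> v Av; have /nbhs_ballP[e /= e0 eA] := open_nbhs_nbhs (conj oA Av).
  (* 2 / (k + 1) < e: a box of this radius that contains v lies in ball v e. *)
  pose k := Num.truncn (2 / e).
  have k0 : 0 < k.+1%:R^-1 :> R by rewrite invr_gt0.
  have ke : k.+1%:R^-1 + k.+1%:R^-1 < e.
    have : 2 / e < k.+1%:R by rewrite truncnS_gt.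
    rewrite ltr_pdivrMr // => h.
    rewrite (_ : _ + _ = 2 / k.+1%:R); last by rewrite mulrDl mul1r.
    by rewrite ltr_pdivrMr// mulrC.
  have /choice[q hq] :
      forall i, exists q : rat, `|ratr q - v ord0 i| < k.+1%:R^-1.
    move=> i; have : v ord0 i - k.+1%:R^-1 < v ord0 i + k.+1%:R^-1.
      by rewrite ltrBlDr -addrA ltrDl addr_gt0.
    move=> /rat_in_itvoo[q]; rewrite in_itv/= => qi; exists q.
    by rewrite ltr_distl.
  exists (\row_i q i, k); last by move=> i _ /=; rewrite mxE.
  move=> w Bw; apply: eA; apply/ball_rVP => // i.
  have := Bw i I; rewrite /= mxE => h.
  apply: le_lt_trans ke; apply: le_trans (ler_distD (ratr (q i)) _ _) _.
  by rewrite lerD// ltW// distrC.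
rewrite bigcup_mkcond; apply: countable_bigcupT_measurable => //.
by move=> p; case: ifPn.
Qed.

Lemma measurable_rV_box (R : realType) n (M : R) :
  measurable [set v : 'rV[R]_n | forall i, `|v ord0 i| <= M].
Proof.
rewrite (_ : mkset _ = \bigcap_(i in [set: 'I_n])
   [set v : 'rV[R]_n | `|v ord0 i| <= M]); last first.
  by apply/seteqP; split=> [v h i _|v h i]; [exact: h|exact: (h i I)].
apply: fin_bigcap_measurable; first exact: finite_finset.
move=> i _; have := @measurable_coor R n i measurableT `[- M, M]%classic
  (measurable_itv _).
rewrite setTI; congr measurable; apply/seteqP.
by split=> v; rewrite /= in_itv/= ler_norml.
Qed.

Lemma lebesgue_rV_box_lty (R : realType) n (M : R) :
  (lebesgue_rV n [set v : 'rV[R]_n | forall i, `|v ord0 i| <= M]%R < +oo)%E.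
Proof.
elim: n => [|n IH].
  rewrite /lebesgue_rV /=; apply: (@le_lt_trans _ _ 1%E); last exact: ltry.
  by rewrite diracE; case: (_ \in _) => //=; rewrite ?lee01.
rewrite /= /lebesgue_rV_step /pushforward.
rewrite (_ : _ @^-1` _ = `[- M, M]%classic `*`
    [set v : 'rV[R]_n | forall i, `|v ord0 i| <= M]); last first.
  apply/seteqP; split=> [[x v]|[x v]] /=.
    move=> h; split.
      by move: (h ord0); rewrite mxE unlift_none in_itv/= ler_norml.
    by move=> i; move: (h (lift ord0 i)); rewrite mxE liftK.
  rewrite in_itv/= -ler_norml => -[h1 h2] i; rewrite mxE.
  by case: unliftP => [j _|_].
rewrite product_measure1E//; last exact: measurable_rV_box.
apply: lte_mul_pinfty => //.
by rewrite [X in X \is a _]lebesgue_measure_itv/=; case: ifP.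
Qed.

Lemma bounded_lebesgue_rV_lty (R : realType) n (A : set 'rV[R]_n) :
  measurable A -> bounded_set A -> (lebesgue_rV n A < +oo)%E.
Proof.
move=> mA [M [_ hM]].
apply: le_lt_trans (lebesgue_rV_box_lty n (M + 1)).
apply: le_measure; rewrite ?inE//; first exact: measurable_rV_box.
move=> v /(hM (M + 1)) vM i; apply: le_trans (vM _); last by rewrite ltrDl.
have /mapP[j Hj ->] : `|v ord0 i| \in [seq `|v x.1 x.2| | x : 'I_1 * 'I_n].
  by apply/mapP; exists (ord0, i) => //=; rewrite mem_enum.
by rewrite [leRHS]/Num.norm /= mx_normrE; apply/bigmax_geP; right => /=; exists j.
Qed.

Lemma continuous_measurable_fun_rV (R : realType) n (A : set 'rV[R]_n)
    (f : 'rV[R]_n -> R) :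
  open A -> (forall x, A x -> {for x, continuous f}) -> measurable_fun A f.
Proof.
move=> oA cf; apply: (measurability _ (RGenOpens.measurableE R)).
move=> _ [_ [a [b ->] <-]]; apply: open_measurable_rV.
rewrite openE => x [Ax fx]; apply: filterI; first exact: open_nbhs_nbhs.
by apply: (cf x Ax); apply: open_nbhs_nbhs; split => //; exact: interval_open.
Qed.

Lemma compact_closure_rV (R : realType) n (A : set 'rV[R]_n) :
  bounded_set A -> compact (closure A).
Proof.
move=> [M [Mr hM]]; apply: bounded_closed_compact; last exact: closed_closure.
exists (M + 1); split; first by rewrite realD// ?real1.
move=> N /ltW MN x; have : closed [set x : 'rV[R]_n | `|x| <= M + 1].
  apply: (@closed_comp _ _ (fun x : 'rV[R]_n => `|x|) [set y | y <= M + 1]).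
    by move=> y _; exact: norm_continuous.
  exact: closed_le.
rewrite closure_id => cl Ax; apply: le_trans MN.
rewrite -/([set x : 'rV[R]_n | `|x| <= M + 1] x) cl.
by apply: closure_subset Ax => y Ay /=; apply: hM Ay; rewrite ltrDl.
Qed.

(** The closure is compact, so continuity there bounds the function, and a
    bounded set has finite measure. *)
Lemma continuous_closure_integrable (R : realType) n (A : set 'rV[R]_n)
    (f : 'rV[R]_n -> R) :
  open A -> bounded_set A -> (forall x, closure A x -> {for x, continuous f}) ->
  (lebesgue_rV n).-integrable A (EFin \o f).
Proof.
move=> oA bA cf; have mA := open_measurable_rV oA.
apply: measurable_bounded_integrable => //.
- exact: bounded_lebesgue_rV_lty.
- apply: continuous_measurable_fun_rV => // x Ax; apply: cf.
  exact: subset_closure.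
have /compact_near_coveringP cK := compact_closure_rV bA.
have : \forall M \near +oo, closure A `<=` [set x | `|f x| <= M].
  apply: cK => x Kx.
  near=> y M => /=; apply: (@le_trans _ _ (`|f x| + 1)); last first.
    by near: M; apply: nbhs_pinfty_ge; rewrite realD.
  rewrite -lerBlDl; apply: le_trans (lerB_dist _ _) _; rewrite distrC.
  near: y; have /cvgrPdist_le := cf x Kx; exact.
case=> M [Mr hM]; exists M; split => // N MN x Ax.
by apply: hM => //; exact: subset_closure.
Unshelve. all: by end_near. Qed.

(** * Calculus of C^k functions *)

Section Ck.
Context (R : realType) (V : normedModType R).
Implicit Types (U W : set V) (f g : V -> R) (k : nat).

Lemma Ck_on_continuous k U f : Ck_on k U f ->
  forall x, U x -> {for x, continuous f}.
Proof. by case: k => [[]|k []]. Qed.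

Lemma Ck_on_derivable k U f v : Ck_on k.+1 U f ->
  forall x, U x -> derivable f x v.
Proof. by case=> _ /(_ v)[]. Qed.

Lemma Ck_on_derive k U f v : Ck_on k.+1 U f -> Ck_on k U ('D_v f).
Proof. by case=> _ /(_ v)[]. Qed.

Lemma Ck_onW k U f : Ck_on k.+1 U f -> Ck_on k U f.
Proof.
elim: k f => [f [cf _]|k IH f [cf df]]; first by split.
by split => // v; have [dv cv] := df v; split => //; exact: IH.
Qed.

Lemma Ck_on_sub k U W f : W `<=` U -> Ck_on k U f -> Ck_on k W f.
Proof.
move=> WU; elim: k f => [f [cf _]|k IH f [cf df]].
  by split => // x /WU; exact: cf.
split=> [x /WU|v]; first exact: cf.
by have [dv cv] := df v; split; [move=> x /WU; exact: dv|exact: IH].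
Qed.

Lemma open_near_eq U f g x : open U -> (forall y, U y -> f y = g y) -> U x ->
  \forall y \near x, f y = g y.
Proof.
by move=> oU fg Ux; apply: filterS (open_nbhs_nbhs (conj oU Ux)) => y; exact: fg.
Qed.

Lemma near_eq_continuous f g x : (\forall y \near x, f y = g y) ->
  {for x, continuous f} -> {for x, continuous g}.
Proof.
move=> fg cf; rewrite /prop_for /continuous_at -(nbhs_singleton fg).
exact: cvg_trans (near_eq_cvg fg) cf.
Qed.

(** Regularity on an open set is local. This lets the rules of differentiation,
    which hold only at the points of U, be used inside the recursion that
    defines Ck_on. *)
Lemma eq_Ck_on k U f g : open U -> (forall x, U x -> f x = g x) ->
  Ck_on k U f -> Ck_on k U g.
Proof.
move=> oU; elim: k f g => [|k IH] f g fg.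
  move=> [cf _]; split => // x Ux.
  exact: near_eq_continuous (open_near_eq oU fg Ux) (cf x Ux).
move=> [cf df]; split.
  by move=> x Ux; exact: near_eq_continuous (open_near_eq oU fg Ux) (cf x Ux).
move=> v; have [dv cv] := df v; split.
  move=> x Ux; apply: near_eq_derivable (dv x Ux).
  exact: (open_near_eq oU fg Ux).
apply: IH cv => x Ux; apply: near_eq_derive.
exact: (open_near_eq oU fg Ux).
Qed.

Lemma Ck_on_cst k U (c : R) : open U -> Ck_on k U (fun=> c).
Proof.
move=> oU; elim: k c => [|k IH] c.
  by split => // x _; exact: cst_continuous.
split=> [x _|v]; first exact: cst_continuous.
split=> [x _|]; first exact: derivable_cst.
by apply: eq_Ck_on (IH 0) => // x _; rewrite derive_cst.
Qed.

Lemma Ck_onD k U f g : open U -> Ck_on k U f -> Ck_on k U g ->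
  Ck_on k U (fun x => f x + g x).
Proof.
move=> oU; elim: k f g => [|k IH] f g Cf Cg.
  split => // x Ux.
  exact: continuousD (Ck_on_continuous Cf Ux) (Ck_on_continuous Cg Ux).
split=> [x Ux|v].
  exact: continuousD (Ck_on_continuous Cf Ux) (Ck_on_continuous Cg Ux).
split=> [x Ux|].
  exact: derivableD (Ck_on_derivable Cf Ux) (Ck_on_derivable Cg Ux).
apply: eq_Ck_on (IH _ _ (Ck_on_derive v Cf) (Ck_on_derive v Cg)) => // x Ux.
exact: esym (deriveD (Ck_on_derivable Cf Ux) (Ck_on_derivable Cg Ux)).
Qed.

Lemma Ck_onM k U f g : open U -> Ck_on k U f -> Ck_on k U g ->
  Ck_on k U (fun x => f x * g x).
Proof.
move=> oU; elim: k f g => [|k IH] f g Cf Cg.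
  split => // x Ux.
  exact: continuousM (Ck_on_continuous Cf Ux) (Ck_on_continuous Cg Ux).
split=> [x Ux|v].
  exact: continuousM (Ck_on_continuous Cf Ux) (Ck_on_continuous Cg Ux).
split=> [x Ux|].
  exact: derivableM (Ck_on_derivable Cf Ux) (Ck_on_derivable Cg Ux).
have h1 := IH _ _ (Ck_onW Cf) (Ck_on_derive v Cg).
have h2 := IH _ _ (Ck_onW Cg) (Ck_on_derive v Cf).
apply: eq_Ck_on (Ck_onD oU h1 h2) => // x Ux.
exact: esym (deriveM (Ck_on_derivable Cf Ux) (Ck_on_derivable Cg Ux)).
Qed.

Lemma Ck_on_sum (I : Type) (r : seq I) k U (F : I -> V -> R) : open U ->
  (forall i, Ck_on k U (F i)) -> Ck_on k U (fun x => \sum_(i <- r) F i x).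
Proof.
move=> oU CF; elim: r => [|i r IH].
  by apply: eq_Ck_on (Ck_on_cst k 0 oU) => // x _; rewrite big_nil.
by apply: eq_Ck_on (Ck_onD oU (CF i) IH) => // x _; rewrite big_cons.
Qed.

End Ck.

Section is_derive_fun.
Context (R : realType) (V : normedModType R).
Implicit Types (f g : V -> R) (p v : V).

(** The rules in pointwise form, which unifies with densities that are built
    from sums and products under a binder. *)
Lemma is_derive_addf f g p v (df dg : R) :
  is_derive p v f df -> is_derive p v g dg ->
  is_derive p v (fun q => f q + g q) (df + dg).
Proof. exact: is_deriveD. Qed.

Lemma is_derive_mulf f g p v (df dg : R) :
  is_derive p v f df -> is_derive p v g dg ->
  is_derive p v (fun q => f q * g q) (f p * dg + g p * df).
Proof. exact: is_deriveM. Qed.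

Lemma is_derive_scalef f p v (c df : R) :
  is_derive p v f df -> is_derive p v (fun q => c * f q) (c * df).
Proof. exact: is_deriveZ. Qed.

Lemma is_derive_sumf (I : Type) (r : seq I) (F : I -> V -> R) (dF : I -> R) p v :
  (forall i, is_derive p v (F i) (dF i)) ->
  is_derive p v (fun q => \sum_(i <- r) F i q) (\sum_(i <- r) dF i).
Proof.
move=> dFi; elim: r => [|i r IH].
  rewrite big_nil (_ : (fun q => _) = cst 0); first exact: is_derive_cst.
  by apply/funext => q; rewrite big_nil.
rewrite big_cons (_ : (fun q => _) = (fun q => F i q + \sum_(j <- r) F j q)).
  exact: is_derive_addf.
by apply/funext => q; rewrite big_cons.
Qed.

Lemma Ck_on_is_derive k (U : set V) f p v :
  Ck_on k.+1 U f -> U p -> is_derive p v f ('D_v f p).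
Proof. by move=> Cf Up; apply: derivableP; exact: Ck_on_derivable Cf _ Up. Qed.

End is_derive_fun.

Lemma derive_add_cst (R : realType) (V : normedModType R) (f : V -> R) (c : R) x v :
  'D_v (fun y => f y + c) x = 'D_v f x.
Proof.
rewrite /derive; set g1 := fun h => h^-1 *: _; set g2 := fun h => h^-1 *: _.
suff -> : g1 = g2 by [].
by apply/funext => h; rewrite /g1 /g2/= opprD addrACA subrr addr0.
Qed.

(** * Symmetry of second derivatives *)

Lemma is_derive_line (R : realType) (V : normedModType R) (f : V -> R) (v y : V)
    (s : R) :
  derivable f (s *: v + y) v ->
  is_derive s (1 : R) (fun s' => f (s' *: v + y)) ('D_v f (s *: v + y)).
Proof.
have E : (fun h : R => h^-1 *:
      (((fun s' => f (s' *: v + y)) \o shift s) (h *: 1) - f (s *: v + y))) =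
    (fun h : R => h^-1 *:
      ((f \o shift (s *: v + y)) (h *: v) - f (s *: v + y))).
  apply/funext => h /=; rewrite /shift/=.
  by rewrite [h *: 1]mulr1 scalerDl addrA.
by move=> df; split; rewrite /derivable /derive E.
Qed.

Lemma MVT_from0 (R : realType) (f df : R -> R) (h : R) : 0 < h ->
  (forall s, 0 <= s <= h -> is_derive s (1 : R) f (df s)) ->
  exists2 s, 0 <= s <= h & f h - f 0 = df s * h.
Proof.
move=> h0 fdf.
have df_oo s : s \in `]0, h[%R -> is_derive s (1 : R) f (df s).
  by rewrite in_itv/= => /andP[/ltW s0 /ltW sh]; apply: fdf; rewrite s0.
have f_cont : {within `[0, h], continuous f}.
  apply: derivable_within_continuous => s; rewrite in_itv/= => sh.
  by have [] := fdf s sh.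
have [s] := @MVT R f df 0 h h0 df_oo f_cont.
rewrite in_itv/= subr0 => /andP[/ltW s0 /ltW sh] E.
by exists s; rewrite ?s0.
Qed.

(** The mean value theorem, applied along v to the increment of f along w and
    then along w to the derivative of f along v. The left-hand side is symmetric
    in v and w up to reordering, whence the symmetry of second derivatives. *)
Lemma second_difference_MVT (R : realType) (V : normedModType R) (f : V -> R)
    (v w x : V) (h : R) : 0 < h ->
  (forall s r, 0 <= s <= h -> 0 <= r <= h ->
    derivable f (s *: v + (r *: w + x)) v /\
    derivable ('D_v f) (s *: v + (r *: w + x)) w) ->
  exists s r, [/\ 0 <= s <= h, 0 <= r <= h &
    (f (h *: v + (h *: w + x)) - f (h *: v + x)) - (f (h *: w + x) - f x) =
    h * (h * 'D_w ('D_v f) (s *: v + (r *: w + x)))].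
Proof.
move=> h0 H.
have hh : 0 <= h <= h by rewrite lexx ltW.
have h00 : 0 <= (0 : R) <= h by rewrite lexx ltW.
pose phi (s : R) := f (s *: v + (h *: w + x)) - f (s *: v + x).
pose dphi (s : R) := 'D_v f (s *: v + (h *: w + x)) - 'D_v f (s *: v + x).
have dP s : 0 <= s <= h -> is_derive s (1 : R) phi (dphi s).
  move=> sh; apply: is_deriveB; apply: is_derive_line.
    exact: (H s h sh hh).1.
  by have [+ _] := H s 0 sh h00; rewrite scale0r add0r.
have [s sh E1] := MVT_from0 h0 dP.
pose psi (r : R) := 'D_v f (r *: w + (s *: v + x)).
pose dpsi (r : R) := 'D_w ('D_v f) (r *: w + (s *: v + x)).
have dQ r : 0 <= r <= h -> is_derive r (1 : R) psi (dpsi r).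
  move=> rh; apply: is_derive_line; rewrite addrCA.
  exact: (H s r sh rh).2.
have [r rh E2] := MVT_from0 h0 dQ.
exists s, r; split => //.
move: E1 E2; rewrite /phi /psi /dphi /dpsi !scale0r !add0r => E1 E2.
have -> : s *: v + (r *: w + x) = r *: w + (s *: v + x) by rewrite addrCA.
rewrite [h * (h * _)]mulrC [h * 'D_w _ _]mulrC -E2.
rewrite [h *: w + (s *: v + x)]addrCA -E1.
by rewrite opprB; ring.
Qed.

(** The second difference of f on a small parallelogram equals h ^ 2 times
    either mixed derivative, taken at some point of the parallelogram; these
    points tend to x with h, and both mixed derivatives are continuous. *)
Lemma derive_swap (R : realType) (V : normedModType R) (U : set V) (f : V -> R)
    (v w x : V) :
  open U -> Ck_on 2 U f -> U x -> 'D_v ('D_w f) x = 'D_w ('D_v f) x.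
Proof.
move=> oU [_ cf] Ux.
have [[dv [_ cv]] [dw [_ cw]]] := (cf v, cf w).
have [[dvw [cvw _]] [dwv [cwv _]]] := (cv w, cw v).
apply/eqP; rewrite -subr_eq0 -normr_le0.
apply/ler_addgt0Pl => e e0; rewrite addr0.
have e2 : 0 < e / 2 by rewrite divr_gt0.
have : \forall p \near x, [/\ U p, `|'D_v ('D_w f) x - 'D_v ('D_w f) p| <= e / 2
    & `|'D_w ('D_v f) x - 'D_w ('D_v f) p| <= e / 2].
  have nU : nbhs x U by exact: open_nbhs_nbhs.
  have /cvgrPdist_le/(_ _ e2) n1 := cwv _ Ux.
  have /cvgrPdist_le/(_ _ e2) n2 := cvw _ Ux.
  have n12 := @filterI _ (nbhs x) (nbhs_filter x) _ _ n1 n2.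
  have := @filterI _ (nbhs x) (nbhs_filter x) _ _ nU n12.
  apply: (@filterS _ (nbhs x) (nbhs_filter x)) => p [Up [p1 p2]].
  exact: And3 Up p1 p2.
case/nbhs_ballP => d /= d0 hd.
pose h := d / (`|v| + `|w| + 1).
have m0 : 0 < `|v| + `|w| + 1 by rewrite ltr_wpDl// addr_ge0.
have h0 : 0 < h by rewrite divr_gt0.
have near_x s r : 0 <= s <= h -> 0 <= r <= h -> ball x d (s *: v + (r *: w + x)).
  move=> /andP[s0 sh] /andP[r0 rh].
  rewrite -ball_normE /= distrC !addrA addrK.
  apply: le_lt_trans (ler_normD _ _) _; rewrite !normrZ !ger0_norm//.
  apply: (@le_lt_trans _ _ (h * (`|v| + `|w|))).
    by rewrite mulrDr lerD// ler_wpM2r.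
  by rewrite /h mulrAC ltr_pdivrMr// ltr_pM2l// ltrDl.
have [||s1 [r1 [s1h r1h E1]]] := @second_difference_MVT R V f v w x h => //.
  by move=> s r sh rh; have [Up _ _] := hd _ (near_x s r sh rh); split; auto.
have [||s2 [r2 [s2h r2h E2]]] := @second_difference_MVT R V f w v x h => //.
  move=> s r sh rh; have [Up _ _] := hd _ (near_x r s rh sh).
  by rewrite addrCA; split; auto.
have E : 'D_w ('D_v f) (s1 *: v + (r1 *: w + x)) =
    'D_v ('D_w f) (s2 *: w + (r2 *: v + x)).
  apply: (mulfI (lt0r_neq0 h0)); apply: (mulfI (lt0r_neq0 h0)).
  apply: etrans (esym E1) _; apply: etrans E2.
  rewrite [h *: w + (h *: v + x)]addrCA.
  have swapAC (a b c e' : R) : (a - b) - (c - e') = (a - c) - (b - e') by ring.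
  exact: swapAC.
have [_ _ b1] := hd _ (near_x _ _ s1h r1h).
have [_ b2 _] := hd _ (near_x _ _ r2h s2h).
rewrite addrCA -E in b2.
rewrite (splitr e).
pose m := 'D_w ('D_v f) (s1 *: v + (r1 *: w + x)).
apply: le_trans (ler_distD m _ _) _.
apply: lerD; first exact: b2.
rewrite distrC; exact: b1.
Qed.

(** * Slices of space-time functions *)

(** Freezing one variable does not change the difference quotients along the
    other one, so partial derivatives of slices are directional derivatives on
    the product. *)
Lemma derive_slice_fst (R : realType) (V : normedModType R)
    (g : R * V -> R) s x r :
  'D_r (fun s' => g (s', x)) s = 'D_((r, 0) : R * V) g (s, x).
Proof.
rewrite /derive; set g1 := fun h => h^-1 *: _; set g2 := fun h => h^-1 *: _.
suff -> : g1 = g2 by [].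
apply/funext => h; rewrite /g1 /g2 /= /shift/= /GRing.scale/=.
by rewrite -[(_, _) + _]/(_, _) scaler0 add0r.
Qed.

Lemma derivable_slice_fst (R : realType) (V : normedModType R)
    (g : R * V -> R) s x r :
  derivable g (s, x) ((r, 0) : R * V) -> derivable (fun s' => g (s', x)) s r.
Proof.
rewrite /derivable; set g1 := fun h => h^-1 *: _; set g2 := fun h => h^-1 *: _.
suff -> : g1 = g2 by [].
apply/funext => h; rewrite /g1 /g2 /= /shift/= /GRing.scale/=.
by rewrite -[(_, _) + _]/(_, _) scaler0 add0r.
Qed.

Lemma derive_slice_snd (R : realType) (V : normedModType R)
    (g : R * V -> R) s x v :
  'D_v (fun y => g (s, y)) x = 'D_((0, v) : R * V) g (s, x).
Proof.
rewrite /derive; set g1 := fun h => h^-1 *: _; set g2 := fun h => h^-1 *: _.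
suff -> : g1 = g2 by [].
apply/funext => h; rewrite /g1 /g2 /= /shift/=.
by rewrite -[h *: (_, _)]/(_, _) -[(_, _) + _]/(_, _) scaler0 add0r.
Qed.

Lemma derivable_slice_snd (R : realType) (V : normedModType R)
    (g : R * V -> R) s x v :
  derivable g (s, x) ((0, v) : R * V) -> derivable (fun y => g (s, y)) x v.
Proof.
rewrite /derivable; set g1 := fun h => h^-1 *: _; set g2 := fun h => h^-1 *: _.
suff -> : g1 = g2 by [].
apply/funext => h; rewrite /g1 /g2 /= /shift/=.
by rewrite -[h *: (_, _)]/(_, _) -[(_, _) + _]/(_, _) scaler0 add0r.
Qed.

Lemma open_slice_snd (R : realType) (V : normedModType R) (W : set (R * V)) t :
  open W -> open [set x | W (t, x)].
Proof.
rewrite !openE => oW x /oW [[Q1 Q2] [/= q1 q2] QW].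
apply: filterS q2 => y Q2y; apply: QW; split => //=; exact: nbhs_singleton q1.
Qed.

Lemma Ck_on_slice_snd (R : realType) (V : normedModType R) k
    (W : set (R * V)) (g : R * V -> R) t :
  Ck_on k W g -> Ck_on k [set x | W (t, x)] (fun x => g (t, x)).
Proof.
have C (h : R * V -> R) (x : V) :
    {for (t, x), continuous h} -> {for x, continuous (fun y => h (t, y))}.
  have pair_t : (fun y : V => (t, y)) y @[y --> x] --> (t, x).
    have := @cvg_pair _ _ _ (nbhs x) (nbhs t) (nbhs x) _ _ _ (fun=> t) id
      (cvg_cst t) cvg_id.
    exact.
  move=> ch; exact: cvg_comp pair_t ch.
elim: k g => [|k IH] g [cg dg].
  by split => // x Wx; apply: C; exact: cg.
split=> [x Wx|v]; first by apply: C; exact: cg.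
have [dv cv] := dg (0, v); split=> [x Wx|].
  by apply: derivable_slice_snd; exact: dv.
have E : 'D_v (fun y => g (t, y)) = (fun y => 'D_(0, v) g (t, y)).
  by apply/funext => x; exact: derive_slice_snd.
by rewrite E; exact: IH cv.
Qed.

Lemma continuous_slice_fst (R : realType) (V : normedModType R)
    (g : R * V -> R) t x :
  {for (t, x), continuous g} -> {for t, continuous (fun s => g (s, x))}.
Proof.
have pair_x : (fun s : R => (s, x)) s @[s --> t] --> (t, x).
  have := @cvg_pair _ _ _ (nbhs t) (nbhs t) (nbhs x) _ _ _ id (fun=> x)
    cvg_id (cvg_cst x).
  exact.
move=> cg; exact: cvg_comp pair_x cg.
Qed.

(** * Differentiation under the integral sign *)

(** Since closure A is compact, a single covering argument provides both an
    interval of times around t on which the slices stay in W and a constant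
    that bounds the time derivative on it; this constant dominates. *)
Lemma is_derive_Rintegral (R : realType) n (A : set 'rV[R]_n)
    (W : set (R * 'rV[R]_n)) (g : R * 'rV[R]_n -> R) (t : R) :
  open A -> bounded_set A -> open W -> Ck_on 1 W g ->
  (forall x, closure A x -> W (t, x)) ->
  is_derive t (1 : R) (fun s => \int[lebesgue_rV n]_(x in A) g (s, x))
    (\int[lebesgue_rV n]_(x in A) 'D_((1, 0) : R * 'rV[R]_n) g (t, x)).
Proof.
move=> oA bA oW [cg /(_ (1, 0))[dg [cdg _]]] tW.
set g' := 'D_(1, 0) g in dg cdg *.
have mA := open_measurable_rV oA.
have /compact_near_coveringP cK := compact_closure_rV bA.
(* The covering is by pairs: a time s close to t and a large bound M. *)
pose P (sM : R * R) x := W (sM.1, x) /\ `|g' (sM.1, x)| <= sM.2.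
have [[Q1 Q2 /= [[e /= e0 eQ] [M [Mr MQ]]] hQ]] :
    filter_prod (nbhs t) (pinfty_nbhs R) [set sM | closure A `<=` P sM].
  apply: (cK _ (filter_prod (nbhs t) (pinfty_nbhs R)) P).
  move=> x Kx.
  have : nbhs (t, x) [set p | W p /\ `|g' p| <= `|g' (t, x)| + 1].
    apply: filterI; first by apply: open_nbhs_nbhs; split => //; exact: tW.
    near=> p => /=; rewrite -lerBlDl; apply: le_trans (lerB_dist _ _) _.
    rewrite distrC; near: p.
    by have /cvgrPdist_le := cdg _ (tW x Kx); exact.
  case=> -[Q1 Q2] /= [Q1t Q2x] hQ.
  exists (Q2, [set sM | Q1 sM.1 /\ `|g' (t, x)| + 1 <= sM.2]) => /=.
    split => //; exists (Q1, [set M | `|g' (t, x)| + 1 <= M]) => //=.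
    by split => //; apply: nbhs_pinfty_ge; rewrite realD.
  move=> [y [s M]] /= [Q2y [Q1s hM]].
  have [Ws gs] := hQ (s, y) (conj Q1s Q2y).
  by split => //; exact: le_trans hM.
pose N := M + 1.
have hN s x : s \in `]t - e, t + e[ -> closure A x ->
    W (s, x) /\ `|g' (s, x)| <= `|N|.
  rewrite in_itv/= => /andP[s1 s2] Kx.
  have [|Wsx gsx] := hQ (s, N) _ x Kx.
    split; last by apply: MQ; rewrite ltrDl.
    by apply: eQ; rewrite /= ltr_distlC s1.
  by split => //; apply: le_trans gsx _; exact: ler_norm.
have gE s x : derive1 (fun s => g (s, x)) s = g' (s, x).
  by rewrite derive1E derive_slice_fst.
have tI : `]t - e, t + e[%classic t.
  by rewrite /= in_itv/= ltrBlDr !ltrDl e0.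
have AK x : A x -> closure A x by move=> ?; exact: subset_closure.
have H1 : forall s, `]t - e, t + e[%classic s ->
    (lebesgue_rV n).-integrable A (EFin \o (fun x => g (s, x))).
  move=> s sI; apply: continuous_closure_integrable => // x Kx.
  have [Ws _] := hN s x sI Kx.
  apply: (@continuous_comp _ _ _ (fun x => (s, x)) g); last exact: cg.
  have := @cvg_pair _ _ _ (nbhs x) (nbhs s) (nbhs x) _ _ _ (fun=> s) id
    (cvg_cst s) cvg_id.
  exact.
have H2 s x : `]t - e, t + e[%classic s -> A x ->
    derivable (fun s => g (s, x)) s 1.
  by move=> sI Ax; apply: derivable_slice_fst; apply: dg; case: (hN s x sI (AK x Ax)).
have H3 : (lebesgue_rV n).-integrable A (EFin \o (fun=> `|N|)).
  apply: continuous_closure_integrable => // x _.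
  exact: (@cst_continuous _ _ `|N| x).
have H4 s x : `]t - e, t + e[%classic s -> A x ->
    `|partial1of2 (fun s x => g (s, x)) s x| <= `|N|.
  move=> sI Ax; rewrite /partial1of2 gE.
  by case: (hN s x sI (AK x Ax)).
split.
  exact: (derivable_under_integral mA tI H1 H2 (fun=> normr_ge0 N) H3 H4).
rewrite -derive1E.
rewrite (differentiation_under_integral mA tI H1 H2 (fun=> normr_ge0 N) H3 H4).
by apply: eq_Rintegral => x _; rewrite /partial1of2 gE.
Unshelve. all: by end_near. Qed.

(** * Green's formula with vanishing flux *)

Lemma ediam_set0 (R : realType) n : ediam (set0 : set 'rV[R]_n) = 0%E.
Proof.
rewrite /ediam (_ : _ |` _ = [set 0%E]) ?ereal_sup1//.
by apply/seteqP; split=> [x [->//|[y []]]|x ->]; left.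
Qed.

Lemma ediam_ge0 (R : realType) n (A : set 'rV[R]_n) : (0 <= ediam A)%E.
Proof. by apply: ereal_sup_ubound; left. Qed.

(** The exponent has to be positive: with 0 ^ 0 = 1, every covering of the empty
    set would have infinite cost. *)
Lemma hausdorff_set0 (R : realType) n s : (0 < s)%N ->
  hausdorff s (set0 : set 'rV[R]_n) = 0%E.
Proof.
case: s => // s _.
rewrite /hausdorff [X in (_ * X)%E](_ : _ = 0%E) ?mule0//.
rewrite (_ : [set _ | _ in _] = [set 0%E]) ?ereal_sup1//.
have pre0 (e : R) : 0 < e -> hausdorff_pre s.+1 e (set0 : set 'rV[R]_n) = 0%E.
  move=> e0; apply/eqP; rewrite eq_le; apply/andP; split.
    apply: ereal_inf_lbound; exists (fun=> set0).
      by split => // k; rewrite ediam_set0 lee_fin ltW.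
    by apply: eseries0 => k _ _; rewrite ediam_set0 expeS mul0e.
  apply: le_ereal_inf_tmp => _ [U _ <-]; apply: nneseries_ge0 => k _ _.
  by apply: expe_ge0; exact: ediam_ge0.
apply/seteqP; split=> [_ [e /= e0 <-]|_ ->]; first exact: pre0.
by exists 1 => //=; exact: pre0.
Qed.

Import HBNNSimple.

(** The surface measure in Green's formula is only known as a set function, so
    linearity of the integral cannot be invoked. A nonnegative simple function
    below 0 is 0, and all its level sets but one are empty. *)
Lemma integral_set_fun0 d (T : measurableType d) (R : realType)
    (mu : set T -> \bar R) (D : set T) (f : T -> \bar R) :
  mu set0 = 0%E -> (forall x, D x -> f x = 0%E) ->
  (\int[mu]_(x in D) f x = 0)%E.
Proof.
move=> mu0 f0; rewrite /integral.
have -> : f \_ D = cst 0%E.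
  by apply/funext => x; rewrite /patch; case: ifPn => //; rewrite inE => /f0.
have sint0 (h : {nnsfun T >-> R}) :
    (forall x, (h x)%:E <= 0)%E -> sintegral mu h = 0%E.
  move=> h0; rewrite /sintegral fsbig1// => r _.
  have [->|r0] := eqVneq r 0; first by rewrite mul0e.
  rewrite (_ : _ @^-1` _ = set0) ?mu0 ?mule0//.
  apply/seteqP; split => // x /= hx; move: (h0 x); rewrite hx lee_fin => r_le0.
  have : 0 <= h x by [].
  by rewrite hx => r_ge0; move: r0; rewrite eq_le r_le0 r_ge0.
have sup0 : ereal_sup [set sintegral mu h | h in [set h : {nnsfun T >-> R} |
    forall x, ((h x)%:E <= 0)%E]] = 0%E.
  rewrite (_ : [set _ | _ in _] = [set 0%E]) ?ereal_sup1//.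
  apply/seteqP; split=> [_ [h /= h0 <-]|_ ->]; first exact: sint0.
  have n0 x : ((@nnsfun0 _ T R x)%:E <= 0)%E by rewrite lee_fin.
  by exists nnsfun0; [exact: n0|exact: sint0].
rewrite (_ : (cst 0)^\+ = cst 0)%E; last first.
  by apply/funext => x; rewrite (@ge0_funeposE _ _ setT) ?inE.
rewrite (_ : (cst 0)^\- = cst 0)%E; last first.
  by apply/funext => x; rewrite (@ge0_funenegE _ _ setT) ?inE.
by rewrite sup0 sube0.
Qed.

Lemma green_flux0 (R : realType) n (A : set 'rV[R]_n)
    (F : 'rV[R]_n -> 'rV[R]_n) (f : 'rV[R]_n -> R) :
  (1 < n)%N -> green_formula A ->
  (forall i, Ck_closed 1 (closure A) (fun x => F x ord0 i)) ->
  Ck_closed 1 (closure A) f ->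
  (forall x, boundary A x -> f x * dot (F x) (unit_normal A x) = 0) ->
  \int[lebesgue_rV n]_(x in A)
    (divergence F x * f x + dot (F x) (gradient f x)) = 0.
Proof.
move=> n1 gA CF Cf bd; have := gA F f CF Cf.
rewrite integral_set_fun0.
- by case.
- by apply: hausdorff_set0; rewrite -subn1 subn_gt0.
- by move=> x /bd ->.
Qed.

(** * Kinematics and stress in space-time *)

Section space_time.
Context {R : realType} {d : nat}.
Local Notation X := (R * 'rV[R]_d)%type.
Implicit Types (W : set X) (g th : X -> R) (v : 'I_d -> X -> R) (p : X).

(** Derivatives with respect to time and to a space coordinate, as directional
    derivatives on space-time. *)
Definition time_deriv g : X -> R := 'D_((1, 0) : X) g.
Definition space_deriv (i : 'I_d) g : X -> R := 'D_((0, delta_mx ord0 i) : X) g.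

Definition st_strain v i j p : R :=
  2^-1 * (space_deriv j (v i) p + space_deriv i (v j) p).
Definition st_div v p : R := \sum_i space_deriv i (v i) p.
(** The identity matrix enters as the number (i == j)%:R, so that every entry is
    a combination of sums and constant multiples of derivatives. *)
Definition st_stress (la mu : R) v (i j : 'I_d) p : R :=
  (i == j)%:R * (la * st_div v p) + 2 * mu * st_strain v i j p.
Definition st_thermal_stress (la mu be Th0 : R) v th (i j : 'I_d) p : R :=
  st_stress la mu v i j p + (- be * (i == j)%:R) * (th p + - Th0).
Definition st_laplacian th p : R := \sum_i space_deriv i (space_deriv i th) p.

Definition st_field (u : R -> 'rV[R]_d -> 'rV[R]_d) (i : 'I_d) p : R :=
  u p.1 p.2 ord0 i.

Lemma partial_slice i g t x :
  partial i (fun y => g (t, y)) x = space_deriv i g (t, x).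
Proof. exact: derive_slice_snd. Qed.

Lemma derive1_slice g t x : derive1 (fun s => g (s, x)) t = time_deriv g (t, x).
Proof. by rewrite derive1E; exact: derive_slice_fst. Qed.

Lemma strain_slice u t x i j :
  strain (u t) x i j = st_strain (st_field u) i j (t, x).
Proof. by rewrite mxE /st_strain -!partial_slice. Qed.

Lemma divergence_slice u t x : divergence (u t) x = st_div (st_field u) (t, x).
Proof. by apply: eq_bigr => i _; rewrite -partial_slice. Qed.

Lemma stress_slice la mu u t x i j :
  stress la mu (u t) x i j = st_stress la mu (st_field u) i j (t, x).
Proof.
rewrite 3!mxE strain_slice divergence_slice /st_stress.
by rewrite [_%:R * (la * _)]mulr_natl.
Qed.

Lemma thermal_stress_slice la mu be Th0 u (Th : R -> 'rV[R]_d -> R) t x i j :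
  thermal_stress la mu be Th0 (u t) (Th t) x i j =
  st_thermal_stress la mu be Th0 (st_field u) (fun p => Th p.1 p.2) i j (t, x).
Proof.
rewrite mxE stress_slice !mxE /st_thermal_stress.
by rewrite mulrAC mulr_natr mulNr mulNrn.
Qed.

Lemma laplacian_slice th t x :
  laplacian (fun y => th (t, y)) x = st_laplacian th (t, x).
Proof.
apply: eq_bigr => i _; have E : partial i (fun y => th (t, y)) =
    (fun y => space_deriv i th (t, y)).
  by apply/funext => y; exact: partial_slice.
by rewrite E; exact: partial_slice.
Qed.

Section regularity.
Variable (W : set X) (oW : open W).

Lemma Ck_on_scale k (c : R) g : Ck_on k W g -> Ck_on k W (fun p => c * g p).
Proof. by move=> Cg; apply: Ck_onM => //; exact: Ck_on_cst. Qed.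

Lemma Ck_on_space_deriv k i g : Ck_on k.+1 W g -> Ck_on k W (space_deriv i g).
Proof. exact: Ck_on_derive. Qed.

Lemma Ck_on_time_deriv k g : Ck_on k.+1 W g -> Ck_on k W (time_deriv g).
Proof. exact: Ck_on_derive. Qed.

Lemma Ck_on_strain k v i j :
  (forall i, Ck_on k.+1 W (v i)) -> Ck_on k W (st_strain v i j).
Proof.
by move=> Cv; apply: Ck_on_scale; apply: Ck_onD => //; exact: Ck_on_space_deriv.
Qed.

Lemma Ck_on_div k v : (forall i, Ck_on k.+1 W (v i)) -> Ck_on k W (st_div v).
Proof. by move=> Cv; apply: Ck_on_sum => // i; exact: Ck_on_space_deriv. Qed.

Lemma Ck_on_stress k la mu v i j : (forall i, Ck_on k.+1 W (v i)) ->
  Ck_on k W (st_stress la mu v i j).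
Proof.
move=> Cv; apply: Ck_onD => //; last by apply: Ck_on_scale; exact: Ck_on_strain.
by apply: Ck_on_scale; apply: Ck_on_scale; exact: Ck_on_div.
Qed.

Lemma Ck_on_thermal_stress k la mu be Th0 v th i j :
  (forall i, Ck_on k.+1 W (v i)) -> Ck_on k W th ->
  Ck_on k W (st_thermal_stress la mu be Th0 v th i j).
Proof.
move=> Cv Cth; apply: Ck_onD => //; first exact: Ck_on_stress.
by apply: Ck_on_scale; apply: Ck_onD => //; exact: Ck_on_cst.
Qed.

Lemma Ck_on_laplacian k th : Ck_on k.+2 W th -> Ck_on k W (st_laplacian th).
Proof.
by move=> Cth; apply: Ck_on_sum => // i; do 2 apply: Ck_on_space_deriv.
Qed.

Variable v : 'I_d -> X -> R.
Hypothesis Cv : forall i, Ck_on 2 W (v i).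
Local Notation w := (fun i => time_deriv (v i)).

(** This is where second derivatives are exchanged: the time derivative of the
    displacement gradient is the gradient of the velocity. *)
Lemma is_derive_space_deriv i j p : W p ->
  is_derive p ((1, 0) : X) (space_deriv j (v i)) (space_deriv j (w i) p).
Proof.
move=> Wp; rewrite /space_deriv /time_deriv -(derive_swap _ _ oW (Cv i) Wp).
exact: Ck_on_is_derive (Ck_on_derive _ (Cv i)) Wp.
Qed.

Lemma is_derive_div p : W p ->
  is_derive p ((1, 0) : X) (st_div v) (st_div w p).
Proof. by move=> Wp; apply: is_derive_sumf => i; exact: is_derive_space_deriv. Qed.

Lemma is_derive_strain i j p : W p ->
  is_derive p ((1, 0) : X) (st_strain v i j) (st_strain w i j p).
Proof.
move=> Wp; apply: is_derive_scalef.
by apply: is_derive_addf; exact: is_derive_space_deriv.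
Qed.

Lemma is_derive_stress la mu i j p : W p ->
  is_derive p ((1, 0) : X) (st_stress la mu v i j) (st_stress la mu w i j p).
Proof.
move=> Wp; apply: is_derive_addf; last first.
  by apply: is_derive_scalef; exact: is_derive_strain.
by apply: is_derive_scalef; apply: is_derive_scalef; exact: is_derive_div.
Qed.

End regularity.

Lemma st_strainC v i j p : st_strain v i j p = st_strain v j i p.
Proof. by rewrite /st_strain addrC. Qed.

Lemma st_stressC la mu v i j p :
  st_stress la mu v i j p = st_stress la mu v j i p.
Proof. by rewrite /st_stress st_strainC eq_sym. Qed.

Lemma st_strain_trace v p : \sum_i st_strain v i i p = st_div v p.
Proof. by apply: eq_bigr => i _; rewrite /st_strain; lra. Qed.

Lemma sum_diag (a : 'I_d -> 'I_d -> R) (c : R) :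
  \sum_i \sum_j (i == j)%:R * c * a i j = c * \sum_i a i i.
Proof.
rewrite mulr_sumr; apply: eq_bigr => i _.
rewrite (bigD1 i)//= eqxx mul1r big1 ?addr0// => j ji.
by rewrite eq_sym (negbTE ji) !mul0r.
Qed.

(** The diagonal part of the stress only sees the trace of the strain, which is
    the divergence; in this form the pairing is visibly symmetric. *)
Lemma stress_strain_pairing la mu v v' p :
  \sum_i \sum_j st_stress la mu v i j p * st_strain v' i j p =
  la * st_div v p * st_div v' p +
  2 * mu * \sum_i \sum_j st_strain v i j p * st_strain v' i j p.
Proof.
rewrite -[st_div v' p]st_strain_trace -(sum_diag (fun i j => st_strain v' i j p)).
rewrite [2 * mu * _]mulr_sumr -big_split/=.
apply: eq_bigr => i _; rewrite [2 * mu * _]mulr_sumr -big_split/=.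
by apply: eq_bigr => j _; rewrite /st_stress mulrDl !mulrA.
Qed.

Lemma stress_strain_sym la mu v v' p :
  \sum_i \sum_j st_stress la mu v i j p * st_strain v' i j p =
  \sum_i \sum_j st_strain v i j p * st_stress la mu v' i j p.
Proof.
rewrite stress_strain_pairing.
under [RHS]eq_bigr do under eq_bigr do rewrite mulrC.
rewrite stress_strain_pairing -!mulrA [st_div v p * _]mulrC; congr (_ + _).
by do 2 congr (_ * _); apply: eq_bigr => i _; apply: eq_bigr => j _; rewrite mulrC.
Qed.

(** The stress is symmetric, hence orthogonal to the skew part of the
    gradient. *)
Lemma stress_strain_gradient la mu v v' p :
  \sum_i \sum_j st_stress la mu v i j p * st_strain v' i j p =
  \sum_i \sum_j st_stress la mu v i j p * space_deriv j (v' i) p.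
Proof.
set a := \sum_i _; set b := \sum_i _.
have bT : b = \sum_i \sum_j st_stress la mu v i j p * space_deriv i (v' j) p.
  rewrite /b exchange_big/=; apply: eq_bigr => i _; apply: eq_bigr => j _.
  by rewrite st_stressC.
suff : a = 2^-1 * (b + b) by lra.
rewrite {2}bT /a /b -big_split mulr_sumr; apply: eq_bigr => i _.
rewrite -big_split mulr_sumr; apply: eq_bigr => j _.
by rewrite /st_strain/=; ring.
Qed.

Lemma thermal_stress_power la mu be Th0 v v' th p :
  \sum_i \sum_j
    st_thermal_stress la mu be Th0 v th i j p * space_deriv j (v' i) p =
  \sum_i \sum_j st_stress la mu v i j p * st_strain v' i j p -
  be * (th p - Th0) * st_div v' p.
Proof.
rewrite stress_strain_gradient -mulNr.
rewrite -(sum_diag (fun i j => space_deriv j (v' i) p)) -big_split/=.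
apply: eq_bigr => i _; rewrite -big_split/=; apply: eq_bigr => j _.
by rewrite /st_thermal_stress; ring.
Qed.

End space_time.

Section densities.
Context {R : realType} {d : nat}.
Implicit Types (th : R * 'rV[R]_d -> R) (v w : 'I_d -> R * 'rV[R]_d -> R).

Definition elastic_density la mu v p : R :=
  \sum_i \sum_j st_stress la mu v i j p * st_strain v i j p.

Definition thermal_density Th0 th p : R := (th p + - Th0) * (th p + - Th0).

Definition gradient_sq th p : R :=
  \sum_j space_deriv j th p * space_deriv j th p.

(** Summed over i, this is the power density sigma* : grad w. *)
Definition stress_power la mu be Th0 v th w i p : R :=
  \sum_j st_thermal_stress la mu be Th0 v th i j p * space_deriv j (w i) p.

(** The divergence of (Th - Th0) grad Th. *)
Definition heat_power Th0 th p : R :=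
  st_laplacian th p * (th p + - Th0) + gradient_sq th p.

End densities.

(** * Integrals of slices *)

Section slice_integral.
Context (R : realType) (d : nat) (A : set 'rV[R]_d).
Context (W : set (R * 'rV[R]_d)) (t : R).
Hypotheses (oA : open A) (bA : bounded_set A) (oW : open W).
Hypothesis tW : forall x, closure A x -> W (t, x).
Implicit Types g h : R * 'rV[R]_d -> R.
Local Notation I g := (\int[lebesgue_rV d]_(x in A) g (t, x)).

Lemma slice_integrable k g : Ck_on k W g ->
  (lebesgue_rV d).-integrable A (EFin \o (fun x => g (t, x))).
Proof.
move=> Cg; apply: continuous_closure_integrable => // x /tW Wx.
by apply: (Ck_on_continuous (Ck_on_slice_snd t Cg)).
Qed.

Lemma slice_integralD g h : Ck_on 0 W g -> Ck_on 0 W h ->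
  \int[lebesgue_rV d]_(x in A) (g (t, x) + h (t, x)) = I g + I h.
Proof.
move=> Cg Ch; apply: RintegralD; first exact: open_measurable_rV.
  exact: slice_integrable Cg.
exact: slice_integrable Ch.
Qed.

Lemma slice_integralZ c g : Ck_on 0 W g ->
  \int[lebesgue_rV d]_(x in A) (c * g (t, x)) = c * I g.
Proof.
move=> Cg; apply: RintegralZl; first exact: open_measurable_rV.
exact: slice_integrable Cg.
Qed.

Lemma slice_integral_sum (J : Type) (r : seq J) (F : J -> R * 'rV[R]_d -> R) :
  (forall j, Ck_on 0 W (F j)) ->
  \int[lebesgue_rV d]_(x in A) (\sum_(j <- r) F j (t, x)) =
  \sum_(j <- r) I (F j).
Proof.
move=> CF; elim: r => [|j r IH].
  by rewrite big_nil /Rintegral integral0_eq// => x _; rewrite big_nil.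
rewrite big_cons -IH.
have Cs : Ck_on 0 W (fun p => \sum_(i <- r) F i p) by exact: Ck_on_sum.
rewrite -[RHS](slice_integralD (CF j) Cs).
by apply: eq_Rintegral => x _; rewrite big_cons.
Qed.

Lemma slice_Ck_closed k g : Ck_on k W g ->
  Ck_closed k (closure A) (fun x => g (t, x)).
Proof.
move=> Cg; exists [set x | W (t, x)]; split => //; first exact: open_slice_snd.
exact: Ck_on_slice_snd.
Qed.

End slice_integral.

(** * The energy identity *)

(** The derivatives at the end points are two-sided limits, but the equations
    are only known inside the interval. *)
Lemma eq0_at_endpoints (R : realType) (g : R -> R) (T t : R) :
  0 < T -> 0 <= t <= T -> {for t, continuous g} ->
  (forall s, 0 < s < T -> g s = 0) -> g t = 0.
Proof.
move=> T0 /andP[t0 tT] cg g0; apply/eqP; rewrite -normr_le0.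
apply/ler_addgt0Pl => e e0; rewrite addr0.
have /cvgrPdist_le/(_ e e0)/nbhs_ballP[r /= r0 hr] := cg.
(* a point of ]0, T[ close to t, on the side of the midpoint T / 2 *)
have [s [s0 sT st]] : exists s, [/\ 0 < s, s < T & `|t - s| < r].
  have [tT2|tT2] := leP t (T / 2).
    exists (t + Num.min r T / 2 / 2).
    have [rT|rT] := leP r T; split; rewrite ?opprD ?addNKr ?normrN ?ger0_norm//; lra.
  exists (t - Num.min r T / 2 / 2).
  have [rT|rT] := leP r T; split; rewrite ?opprB ?subKr ?ger0_norm//; lra.
have := hr s; rewrite -ball_normE/= => /(_ st).
by rewrite (g0 s) ?s0// subr0.
Qed.

Section biot.
Context (R : realType) (d : nat) (Om : set 'rV[R]_d) (W : set (R * 'rV[R]_d)).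
Hypotheses (hd : (1 < d)%N) (hOm : regular_bounded_domain Om) (oW : open W).
Context (T mu la be Th0 chi ka0 : R).
Hypotheses (T_gt0 : 0 < T) (Th0_gt0 : 0 < Th0).
Hypothesis W_cyl : forall t x, 0 <= t <= T -> closure Om x -> W (t, x).
Context (v : 'I_d -> R * 'rV[R]_d -> R) (th : R * 'rV[R]_d -> R).
Hypotheses (Cv : forall i, Ck_on 2 W (v i)) (Cth : Ck_on 2 W th).
Local Notation w := (fun i => time_deriv (v i)).
Local Notation sg := (st_thermal_stress la mu be Th0 v th).
Local Notation I t g := (\int[lebesgue_rV d]_(x in Om) g (t, x)).

Let oOm : open Om := domain_open hOm.
Let bOm : bounded_set Om := domain_bounded hOm.

Let Cw i : Ck_on 1 W (w i). Proof. exact: Ck_on_time_deriv (Cv i). Qed.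
Let Cth1 : Ck_on 1 W th. Proof. exact: Ck_onW. Qed.
Let Csg i j : Ck_on 1 W (sg i j). Proof. exact: Ck_on_thermal_stress. Qed.
Let Cth0 k : Ck_on k W th -> Ck_on k W (fun p => th p + - Th0).
Proof. by move=> Ct; apply: Ck_onD => //; exact: Ck_on_cst. Qed.

(** Used for the velocity on the boundary and for the heat equation at time 0. *)
Lemma vanish_on_time_interval (g : R * 'rV[R]_d -> R) x :
  closure Om x -> Ck_on 0 W g -> (forall s, 0 < s < T -> g (s, x) = 0) ->
  forall t, 0 <= t <= T -> g (t, x) = 0.
Proof.
move=> clx Cg g0 t ht; apply: (@eq0_at_endpoints R (fun s => g (s, x)) T) => //.
by apply: continuous_slice_fst; apply: (Ck_on_continuous Cg); exact: W_cyl.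
Qed.

(** At an end point the trace is constant on one side only, while the velocity
    is a two-sided derivative; its continuity in time settles the matter. *)
Lemma constant_trace_rate0 (GD : set 'rV[R]_d) i :
  GD `<=` closure Om ->
  (forall s t x, 0 <= s <= T -> 0 <= t <= T -> GD x ->
    v i (s, x) = v i (t, x)) ->
  forall t x, 0 <= t <= T -> GD x -> w i (t, x) = 0.
Proof.
move=> GDcl vD t x ht GDx.
apply: (vanish_on_time_interval (g := w i)) ht; first exact: GDcl.
  exact: Ck_onW.
move=> s /andP[s0 sT]; rewrite -derive1_slice derive1E.
rewrite (@near_eq_derive _ _ _ _ (cst (v i (s, x)))) ?derive_cst//.
have sI : s \in `]0, T[%R by rewrite in_itv/= s0.
apply: filterS (near_in_itvoo sI) => r; rewrite in_itv/= => /andP[r0 rT].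
by apply: vD => //; rewrite !ltW.
Qed.

(** Green's formula for the i-th row of the thermal stress and the i-th velocity
    component: on each part of the boundary one of the two factors of the flux
    vanishes, and so does the divergence inside. *)
Lemma power_balance (GD GN : set 'rV[R]_d) t i :
  0 <= t <= T -> boundary Om = GD `|` GN ->
  (forall x, GD x -> w i (t, x) = 0) ->
  (forall x, GN x -> \sum_j sg i j (t, x) * unit_normal Om x ord0 j = 0) ->
  (forall x, Om x -> divergence (fun y => \row_j sg i j (t, y)) x = 0) ->
  \int[lebesgue_rV d]_(x in Om)
    (\sum_j sg i j (t, x) * space_deriv j (w i) (t, x)) = 0.
Proof.
move=> ht bd wD sgN div0; have tW x : closure Om x -> W (t, x) := W_cyl ht.
have Cflux j :
    Ck_closed 1 (closure Om) (fun x => (\row_j sg i j (t, x)) ord0 j).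
  rewrite (_ : (fun x => _) = fun x => sg i j (t, x)).
    by apply: slice_Ck_closed (Csg i j).
  by apply/funext => x; rewrite mxE.
have Cwi := slice_Ck_closed oW tW (Cw i).
apply: etrans; last apply: (green_flux0 hd (domain_green hOm) Cflux Cwi).
  apply: eq_Rintegral => x; rewrite inE => Omx.
  rewrite div0// mul0r add0r /dot; apply: eq_bigr => j _.
  by rewrite !mxE partial_slice.
move=> x; rewrite bd => -[GDx|GNx]; first by rewrite wD// mul0r.
rewrite [dot _ _](_ : _ = 0) ?mulr0// -(sgN x GNx).
by apply: eq_bigr => j _; rewrite mxE.
Qed.

(** Green's formula for grad Th and Th - Th0; again each part of the boundary
    kills one factor of the flux. *)
Lemma heat_balance (GD GN : set 'rV[R]_d) t :
  0 <= t <= T -> boundary Om = GD `|` GN ->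
  (forall x, GD x -> th (t, x) = Th0) ->
  (forall x, GN x ->
    \sum_j space_deriv j th (t, x) * unit_normal Om x ord0 j = 0) ->
  \int[lebesgue_rV d]_(x in Om) (st_laplacian th (t, x) * (th (t, x) + - Th0) +
    \sum_j space_deriv j th (t, x) * space_deriv j th (t, x)) = 0.
Proof.
move=> ht bd thD thN; have tW x : closure Om x -> W (t, x) := W_cyl ht.
have Cflux j : Ck_closed 1 (closure Om)
    (fun x => (\row_j space_deriv j th (t, x)) ord0 j).
  rewrite (_ : (fun x => _) = fun x => space_deriv j th (t, x)).
    by apply: slice_Ck_closed (Ck_on_space_deriv j Cth).
  by apply/funext => x; rewrite mxE.
have Cf := slice_Ck_closed oW tW (Cth0 Cth1).
apply: etrans; last apply: (green_flux0 hd (domain_green hOm) Cflux Cf).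
  apply: eq_Rintegral => x _; congr (_ * _ + _).
    apply: eq_bigr => i _; rewrite -partial_slice.
    have -> : (fun y => (\row_j space_deriv j th (t, y)) ord0 i) =
        (fun y => space_deriv i th (t, y)) by apply/funext => y; rewrite mxE.
    by [].
  apply: eq_bigr => j _; rewrite !mxE; congr (_ * _).
  by rewrite -partial_slice /partial derive_add_cst.
move=> x; rewrite bd => -[GDx|GNx]; first by rewrite thD// subrr mul0r.
rewrite [dot _ _](_ : _ = 0) ?mulr0// -(thN x GNx).
by apply: eq_bigr => j _; rewrite mxE.
Qed.

Local Notation energy_density := (elastic_density la mu v).
Local Notation heat_density := (thermal_density Th0 th).
Local Notation grad_sq := (gradient_sq th).
Local Notation power := (stress_power la mu be Th0 v th w).
Local Notation heat_flux := (heat_power Th0 th).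

(** The density is quadratic in the strain, and the symmetry of the pairing
    merges the two terms of the product rule. *)
Lemma elastic_density_rate p : W p ->
  time_deriv energy_density p =
  2 * \sum_i \sum_j st_stress la mu v i j p * st_strain w i j p.
Proof.
move=> Wp.
have D : is_derive p ((1, 0) : R * 'rV[R]_d) energy_density
    (\sum_i \sum_j (st_stress la mu v i j p * st_strain w i j p +
                    st_strain v i j p * st_stress la mu w i j p)).
  apply: is_derive_sumf => i; apply: is_derive_sumf => j.
  apply: is_derive_mulf; first exact: (is_derive_stress oW Cv).
  exact: (is_derive_strain oW Cv).
apply: etrans (@derive_val _ _ _ _ _ _ _ D) _.
under eq_bigr do rewrite big_split/=.
by rewrite big_split/= -stress_strain_sym mulrDl mul1r.
Qed.

Lemma thermal_density_rate p : W p ->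
  time_deriv heat_density p = 2 * ((th p - Th0) * time_deriv th p).
Proof.
move=> Wp.
have D1 : is_derive p ((1, 0) : R * 'rV[R]_d) (fun q => th q + - Th0)
    (time_deriv th p + 0).
  by apply: is_derive_addf; exact: Ck_on_is_derive Cth Wp.
have D := is_derive_mulf D1 D1.
apply: etrans (@derive_val _ _ _ _ _ _ _ D) _; rewrite addr0 /=; ring.
Qed.

(** Pointwise, the rate of the total energy density plus the dissipation is a
    combination of the integrands of power_balance and heat_balance: the heat
    equation produces the term - be * (Th - Th0) * div w, and the thermal part
    of the stress produces the same term. *)
Lemma energy_identity t : 0 <= t <= T ->
  (forall i, I t (power i) = 0) -> I t heat_flux = 0 ->
  (forall x, Om x -> chi * time_deriv th (t, x) =
    ka0 * st_laplacian th (t, x) - Th0 * be * st_div w (t, x)) ->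
  is_derive t (1 : R)
    (fun s => 2^-1 * I s energy_density + chi / (2 * Th0) * I s heat_density)
    (- (ka0 / Th0) * I t grad_sq).
Proof.
move=> ht power0 flux0 heat.
have tW x : closure Om x -> W (t, x) := W_cyl ht.
have Ce : Ck_on 1 W energy_density.
  have Cij i j : Ck_on 1 W
      (fun p => st_stress la mu v i j p * st_strain v i j p).
    exact: Ck_onM oW (Ck_on_stress oW la mu i j Cv) (Ck_on_strain oW i j Cv).
  have Ci i : Ck_on 1 W
      (fun p => \sum_j st_stress la mu v i j p * st_strain v i j p).
    exact: Ck_on_sum oW (Cij i).
  exact: Ck_on_sum oW Ci.
have Ch : Ck_on 1 W heat_density := Ck_onM oW (Cth0 Cth1) (Cth0 Cth1).
have Cgrad : Ck_on 0 W grad_sq.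
  by apply: Ck_on_sum => // j; apply: Ck_onM => //; exact: Ck_on_space_deriv.
have Cpower i : Ck_on 0 W (power i).
  apply: Ck_on_sum => // j; apply: Ck_onM => //; first exact: Ck_onW (Csg i j).
  exact: Ck_on_space_deriv (Cw i).
have Cflux : Ck_on 0 W heat_flux.
  apply: Ck_onD => //; apply: Ck_onM => //; first exact: Ck_on_laplacian.
  by apply: Cth0; exact: Ck_onW.
have Ie := is_derive_Rintegral oOm bOm oW Ce tW.
have Ih := is_derive_Rintegral oOm bOm oW Ch tW.
have D := is_derive_addf (is_derive_scalef 2^-1 Ie)
  (is_derive_scalef (chi / (2 * Th0)) Ih).
apply: (is_derive_eq D).
have Ce' : Ck_on 0 W (time_deriv energy_density) by exact: Ck_on_time_deriv.
have Ch' : Ck_on 0 W (time_deriv heat_density) by exact: Ck_on_time_deriv.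
rewrite -/(time_deriv energy_density) -/(time_deriv heat_density).
have key x : Om x ->
    2^-1 * time_deriv energy_density (t, x) +
    chi / (2 * Th0) * time_deriv heat_density (t, x) + ka0 / Th0 * grad_sq (t, x) =
    \sum_i power i (t, x) + ka0 / Th0 * heat_flux (t, x).
  move=> Omx; have Wp : W (t, x) by apply: tW; exact: subset_closure.
  rewrite elastic_density_rate// thermal_density_rate//.
  rewrite [X in _ = X + _]thermal_stress_power /heat_power.
  have Th0N0 : Th0 != 0 by rewrite gt_eqF.
  have -> : chi / (2 * Th0) * (2 * ((th (t, x) - Th0) * time_deriv th (t, x))) =
      (th (t, x) - Th0) / Th0 * (chi * time_deriv th (t, x)) by field.
  by rewrite heat//; field.
apply/eqP; rewrite mulNr -subr_eq0 opprK.
have CG : Ck_on 0 W (fun p => 2^-1 * time_deriv energy_density p).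
  exact: Ck_on_scale.
have CH : Ck_on 0 W (fun p => chi / (2 * Th0) * time_deriv heat_density p).
  exact: Ck_on_scale.
have CN : Ck_on 0 W (fun p => ka0 / Th0 * grad_sq p) by exact: Ck_on_scale.
have CF : Ck_on 0 W (fun p => ka0 / Th0 * heat_flux p) by exact: Ck_on_scale.
have CP : Ck_on 0 W (fun p => \sum_i power i p) by exact: Ck_on_sum.
rewrite -(slice_integralZ oOm bOm tW _ Ce') -(slice_integralZ oOm bOm tW _ Ch').
rewrite -(slice_integralZ oOm bOm tW _ Cgrad).
rewrite -(slice_integralD oOm bOm tW CG CH).
rewrite -(slice_integralD oOm bOm tW (Ck_onD oW CG CH) CN).
rewrite (@eq_Rintegral _ _ _ (lebesgue_rV d) Om
  (fun x => \sum_i power i (t, x) + ka0 / Th0 * heat_flux (t, x))).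
  rewrite (slice_integralD oOm bOm tW CP CF) (slice_integralZ oOm bOm tW _ Cflux).
  rewrite flux0 mulr0 addr0 (slice_integral_sum oOm bOm oW tW _ Cpower).
  by rewrite big1// => i _; exact: power0.
by move=> x; rewrite inE; exact: key.
Qed.

(** Both sides are continuous in time, up to time 0. *)
Lemma heat_equation_up_to_initial_time :
  (forall t x, 0 < t <= T -> Om x -> chi * time_deriv th (t, x) =
    ka0 * st_laplacian th (t, x) - Th0 * be * st_div w (t, x)) ->
  forall t x, 0 <= t <= T -> Om x -> chi * time_deriv th (t, x) =
    ka0 * st_laplacian th (t, x) - Th0 * be * st_div w (t, x).
Proof.
move=> heat t x ht Omx; apply/eqP; rewrite -subr_eq0; apply/eqP.
pose defect p := chi * time_deriv th p +
  -1 * (ka0 * st_laplacian th p + - (Th0 * be) * st_div w p).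
suff: defect (t, x) = 0 by rewrite /defect mulN1r mulNr.
apply: (vanish_on_time_interval (g := defect)) ht.
- exact: subset_closure.
- apply: Ck_onD => //; apply: Ck_on_scale => //.
    by apply: Ck_on_time_deriv; exact: Cth1.
  apply: Ck_onD => //; apply: Ck_on_scale => //; first exact: Ck_on_laplacian.
  exact: Ck_on_div.
- move=> s /andP[s0 sT]; rewrite /defect heat ?s0 ?ltW//.
  by rewrite mulN1r mulNr subrr.
Qed.

End biot.

Lemma open_forall (T : topologicalType) (I : finType) (W : I -> set T) :
  (forall i, open (W i)) -> open [set p | forall i, W i p].
Proof.
move=> oW; rewrite (_ : mkset _ = ~` (\bigcup_(i in [set: I]) ~` W i)).
  apply: closed_openC; apply: closed_bigcup; first exact: finite_finset.
  by move=> i _; exact: open_closedC.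
apply/seteqP; split=> [p h [i _ /(_ (h i))]//|p h i].
by apply: contrapT => nWp; apply: h; exists i.
Qed.

Theorem theorem2p4 (R : realType) (d : nat) (hd : d = 2%N \/ d = 3%N)
    (Om : set 'rV[R]_d) (hOm : regular_bounded_domain Om)
    (GDu GNu GDTh GNTh : set 'rV[R]_d)
    (hGu : boundary Om = GDu `|` GNu) (hGu0 : GDu `&` GNu = set0)
    (hGTh : boundary Om = GDTh `|` GNTh) (hGTh0 : GDTh `&` GNTh = set0)
    (hGDu : (0 < hausdorff d.-1 GDu)%E)
    (T : R) (hT : 0 < T)
    (mu la aL be Th0 chi ka0 : R)
    (hmu : 0 < mu) (hla : - (2 * mu / d%:R) < la) (haL : 0 < aL)
    (hbe : be = aL * (d%:R * la + 2 * mu))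
    (hTh0 : 0 < Th0) (hchi : 0 < chi) (hka0 : 0 < ka0)
    (uD : R -> 'rV[R]_d -> 'rV[R]_d) (ThD : R -> 'rV[R]_d -> R)
    (Thstar : 'rV[R]_d -> R)
    (u : R -> 'rV[R]_d -> 'rV[R]_d) (Th : R -> 'rV[R]_d -> R)
    (u_smooth : forall i, Ck_closed 2 (`[0, T] `*` closure Om)
       (fun p : R * 'rV[R]_d => u p.1 p.2 ord0 i))
    (Th_smooth : Ck_closed 2 (`[0, T] `*` closure Om)
       (fun p : R * 'rV[R]_d => Th p.1 p.2))
    (equilibrium : forall t x, 0 <= t <= T -> Om x ->
       - mx_divergence (thermal_stress la mu be Th0 (u t) (Th t)) x = 0)
    (heat : forall t x, 0 < t <= T -> Om x ->
       chi * derive1 (fun s => Th s x) t =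
       ka0 * laplacian (Th t) x
       - Th0 * be * derive1 (fun s => divergence (u s) x) t)
    (bc_uD : forall t x, 0 <= t <= T -> GDu x -> u t x = uD t x)
    (bc_uN : forall t x, 0 <= t <= T -> GNu x ->
       thermal_stress la mu be Th0 (u t) (Th t) x *m (unit_normal Om x)^T = 0)
    (bc_ThD : forall t x, 0 <= t <= T -> GDTh x -> Th t x = ThD t x)
    (bc_ThN : forall t x, 0 <= t <= T -> GNTh x ->
       dot (gradient (Th t) x) (unit_normal Om x) = 0)
    (init_Th : forall x, Om x -> Th 0 x = Thstar x)
    (uD_const : forall s t x, 0 <= s <= T -> 0 <= t <= T -> GDu x ->
       uD s x = uD t x)
    (ThD_const : forall t x, 0 <= t <= T -> GDTh x -> ThD t x = Th0) :
  forall t, 0 <= t <= T ->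
    is_derive t (1 : R)
      (fun s => elastic_energy Om la mu (u s) + thermal_energy Om chi Th0 (Th s))
      (- (ka0 / Th0) *
         \int[lebesgue_rV d]_(x in Om) enorm (gradient (Th t) x) ^+ 2) /\
    - (ka0 / Th0) *
       \int[lebesgue_rV d]_(x in Om) enorm (gradient (Th t) x) ^+ 2 <= 0.
Proof.
have d_gt1 : (1 < d)%N by case: hd => ->.
pose v := st_field u; pose th p := Th p.1 p.2.
have [Wu Wu_spec] := choice u_smooth.
have [Wth [oWth KWth CWth]] := Th_smooth.
pose W := [set p | forall i, Wu i p] `&` Wth.
have oW : open W.
  by apply: openI => //; apply: open_forall => i; case: (Wu_spec i).
have W_cyl t x : 0 <= t <= T -> closure Om x -> W (t, x).
  move=> ht clx; have cyl : (`[0, T] `*` closure Om) (t, x).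
    by split => //; rewrite /= in_itv.
  by split; [move=> i; case: (Wu_spec i) => _ + _; exact|exact: KWth].
have Cv i : Ck_on 2 W (v i).
  by case: (Wu_spec i) => _ _; apply: Ck_on_sub => p [].
have Cth : Ck_on 2 W th by apply: Ck_on_sub CWth => p [].
pose w i := time_deriv (v i).
have bd_cl : boundary Om `<=` closure Om by move=> x [].
have wD i t x : 0 <= t <= T -> GDu x -> w i (t, x) = 0.
  apply: (constant_trace_rate0 hT W_cyl Cv).
    by move=> y GDy; apply: bd_cl; rewrite hGu; left.
  move=> s r y hs hr GDy; rewrite /v /st_field /=.
  by rewrite !bc_uD// (uD_const s r).
(* The equations and boundary conditions concern slices at a fixed time; the
   next steps restate them for the fields on space-time. *)
have power0 t i : 0 <= t <= T ->
    \int[lebesgue_rV d]_(x in Om) stress_power la mu be Th0 v th w i (t, x) = 0.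
  move=> ht; apply: (power_balance d_gt1 hOm oW W_cyl Cv Cth ht hGu) => x.
  - exact: wD.
  - move=> GNx; have := bc_uN t x ht GNx => /matrixP/(_ i ord0).
    rewrite !mxE => traction0; apply: etrans traction0; apply: eq_bigr => j _.
    by rewrite thermal_stress_slice mxE.
  - move=> Omx; have := equilibrium t x ht Omx => /rowP/(_ i).
    rewrite !mxE => /eqP; rewrite oppr_eq0 => /eqP div0; apply: etrans div0.
    congr (divergence _ x); apply/funext => y; apply/rowP => j.
    by rewrite [LHS]mxE [RHS]mxE thermal_stress_slice.
have flux0 t : 0 <= t <= T ->
    \int[lebesgue_rV d]_(x in Om) heat_power Th0 th (t, x) = 0.
  move=> ht; apply: (heat_balance d_gt1 hOm oW W_cyl Cth ht hGTh) => x.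
  - by move=> GDx; rewrite /th/= bc_ThD// ThD_const.
  - move=> GNx; apply: etrans (bc_ThN t x ht GNx); apply: eq_bigr => j _.
    by rewrite mxE -partial_slice.
have heat_w : forall t x, 0 <= t <= T -> Om x -> chi * time_deriv th (t, x) =
    ka0 * st_laplacian th (t, x) - Th0 * be * st_div w (t, x).
  apply: (heat_equation_up_to_initial_time oW hT W_cyl Cv Cth) => t x ht Omx.
  have Wtx : W (t, x).
    case/andP: ht => /ltW t0 tT; apply: W_cyl; first by rewrite t0.
    exact: subset_closure.
  rewrite -derive1_slice (heat t x ht Omx) -laplacian_slice; congr (_ - _ * _).
  rewrite (_ : (fun s => _) = fun s => st_div v (s, x)).
    rewrite derive1_slice.
    exact: (@derive_val _ _ _ _ _ _ _ (is_derive_div oW Cv Wtx)).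
  by apply/funext => s; rewrite divergence_slice.
move=> t ht.
have gradE x : enorm (gradient (Th t) x) ^+ 2 = gradient_sq th (t, x).
  rewrite /enorm sqr_sqrtr.
    by apply: eq_bigr => j _; rewrite mxE -partial_slice.
  by apply: sumr_ge0 => j _; rewrite -expr2 sqr_ge0.
under eq_Rintegral do rewrite gradE.
split; last first.
  rewrite mulNr oppr_le0 mulr_ge0//; first by rewrite divr_ge0 ?ltW.
  by apply: Rintegral_ge0 => x _; rewrite -gradE sqr_ge0.
have -> : (fun s => elastic_energy Om la mu (u s) +
      thermal_energy Om chi Th0 (Th s)) =
    (fun s => 2^-1 *
        \int[lebesgue_rV d]_(x in Om) elastic_density la mu v (s, x) +
      chi / (2 * Th0) *
        \int[lebesgue_rV d]_(x in Om) thermal_density Th0 th (s, x)).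
  apply/funext => s; congr (_ * _ + _ * _); apply: eq_Rintegral => x _.
    apply: eq_bigr => i _; apply: eq_bigr => j _.
    by rewrite stress_slice strain_slice.
  by rewrite real_normK ?num_real// expr2.
apply: (energy_identity hOm oW hTh0 W_cyl Cv Cth ht) => //.
- by move=> i; exact: power0.
- exact: flux0.
- by move=> x; exact: heat_w.
Qed.
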